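(* For any integer $n > 1$, \[(n-1)^{n-1} \;=\; \sum_{(k_1,\dots,k_{n-2})} \binom{n}{k_1}\binom{n-k_1}{k_2} \cdots \binom{n-(k_1+\dots+k_{n-3})}{k_{n-2}},\] where the sum is over all tuples $(k_1,\dots,k_{n-2})$ of nonnegative integers satisfying $0 \le k_1 + \dots + k_j \le j$ for every $j = 1, 2, \dots, n-2$.
   Context: For $n=2$ the sum is over the single empty tuple and the corresponding empty product equals $1$. *)

(* Defs.v *)
From mathcomp Require Import all_boot.
Set Implicit Arguments.
Unset Strict Implicit.
Unset Printing Implicit Defensive.

(* A tuple (k_1, ..., k_m) is a function k on 'I_m, with k_i stored at i - 1;
   [psum k j] is k_1 + ... + k_j, for j <= m. *)
Definition psum (m n : nat) (k : {ffun 'I_m -> 'I_n}) (j : nat) : nat :=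
  \sum_(i < m | i < j) k i.

(* k_1 + ... + k_j <= j for every j = 1, ..., m (here j.+1, with j : 'I_m). *)
Definition admissible (m n : nat) (k : {ffun 'I_m -> 'I_n}) : bool :=
  [forall j : 'I_m, psum k j.+1 <= j.+1].

(* Taking the entries in 'I_n makes the index type finite and, for m < n,
   excludes no tuple of natural numbers: the partial-sum condition forces
   k_j <= k_1 + ... + k_j <= j <= m < n. *)
Lemma admissible_entry_lt (m n : nat) (k : 'I_m -> nat) (ltmn : m < n)
    (hk : forall j : 'I_m, \sum_(i < m | i < j.+1) k i <= j.+1) (j : 'I_m) :
  k j < n.
Proof.
apply: leq_ltn_trans ltmn; apply: leq_trans (ltn_ord j).
by apply: leq_trans (hk j); rewrite (bigD1 j) //= leq_addr.
Qed.

(* Main.v *)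
Require Import Defs.
From mathcomp Require Import all_boot.
From mathcomp Require Import zify ring.

Set Implicit Arguments.
Unset Strict Implicit.
Unset Printing Implicit Defensive.

(** Group the tuples by their total [S = k_1 + ... + k_m].  Splitting off the last
entry and using [C(n, T) C(n - T, S - T) = C(n, S) C(S, T)], induction on [m] and
the binomial theorem show that the tuples of total [S] contribute
[C(n, S) (m + 1 - S) (m + 1)^(S - 1)], as in the count of partial parking
functions of [S] cars on [m] spots.  For [m = n - 2] and [N = n - 1] this is
[C(N, S) N^S - C(N, S - 1) N^(S - 1)], so the sum over [S] telescopes. *)

(** Taking a pair as argument makes this a bijection usable directly for reindexing sums over tuples
    of length [m.+1]. *)
Definition ffun_rcons (T : Type) (m : nat) (p : {ffun 'I_m -> T} * T) :
    {ffun 'I_m.+1 -> T} :=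
  [ffun i => if unlift ord_max i is Some j then p.1 j else p.2].

Lemma ffun_rcons_widen (T : Type) (m : nat) (f : {ffun 'I_m -> T}) (a : T)
    (i : 'I_m) :
  ffun_rcons (f, a) (widen_ord (leqnSn m) i) = f i.
Proof.
rewrite ffunE; have -> : widen_ord (leqnSn m) i = lift ord_max i.
  by apply: val_inj; rewrite /= /bump leqNgt ltn_ord.
by rewrite liftK.
Qed.

Lemma ffun_rcons_max (T : Type) (m : nat) (f : {ffun 'I_m -> T}) (a : T) :
  ffun_rcons (f, a) ord_max = a.
Proof. by rewrite ffunE unlift_none. Qed.

Lemma ffun_rcons_bij (T : Type) (m : nat) : bijective (@ffun_rcons T m).
Proof.
exists (fun g : {ffun 'I_m.+1 -> T} =>
  ([ffun i => g (widen_ord (leqnSn m) i)], g ord_max)).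
- move=> [f a]; congr (_, _); last exact: ffun_rcons_max.
  by apply/ffunP => i; rewrite ffunE ffun_rcons_widen.
- move=> g; apply/ffunP => i; rewrite ffunE.
  case: unliftP => [j|] -> //=; rewrite ffunE; congr (g _).
  by apply: val_inj; rewrite /= /bump leqNgt ltn_ord.
Qed.

Lemma psum_rcons (m n : nat) (f : {ffun 'I_m -> 'I_n}) (a : 'I_n) (j : nat) :
  j <= m -> psum (ffun_rcons (f, a)) j = psum f j.
Proof.
move=> lejm; rewrite /psum big_mkcond big_ord_recr /= ltnNge lejm addn0.
by rewrite [RHS]big_mkcond; apply: eq_bigr => i _; rewrite ffun_rcons_widen.
Qed.

Lemma psum_full (m n : nat) (k : {ffun 'I_m -> 'I_n}) :
  psum k m = \sum_(i < m) k i.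
Proof. by apply: eq_bigl => i; rewrite ltn_ord. Qed.

Lemma psum_rcons_full (m n : nat) (f : {ffun 'I_m -> 'I_n}) (a : 'I_n) :
  psum (ffun_rcons (f, a)) m.+1 = psum f m + a.
Proof.
rewrite !psum_full big_ord_recr /= ffun_rcons_max; congr (_ + _).
by apply: eq_bigr => i _; rewrite ffun_rcons_widen.
Qed.

Lemma admissible_rcons (m n : nat) (f : {ffun 'I_m -> 'I_n}) (a : 'I_n) :
  admissible (ffun_rcons (f, a)) = admissible f && (psum f m + a <= m.+1).
Proof.
apply/forallP/andP => [adm | [/forallP adm le_max] j].
  split; last by rewrite -psum_rcons_full; apply: (adm ord_max).
  apply/forallP => j; rewrite -(psum_rcons f a) //.
  exact: (adm (widen_ord (leqnSn m) j)).
have [ltjm | lemj] := ltnP j m.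
  by rewrite psum_rcons //; apply: (adm (Ordinal ltjm)).
have -> : nat_of_ord j = m by apply/eqP; rewrite eqn_leq lemj -ltnS ltn_ord.
by rewrite psum_rcons_full.
Qed.

Lemma admissible_psum_le (m n : nat) (k : {ffun 'I_m -> 'I_n}) :
  admissible k -> psum k m <= m.
Proof.
case: m k => [|m] k; first by rewrite psum_full big_ord0.
by move/forallP/(_ ord_max).
Qed.

Definition weight (m n : nat) (k : {ffun 'I_m -> 'I_n}) : nat :=
  \prod_(j < m) 'C(n - psum k j, k j).

Lemma weight_rcons (m n : nat) (f : {ffun 'I_m -> 'I_n}) (a : 'I_n) :
  weight (ffun_rcons (f, a)) = weight f * 'C(n - psum f m, a).
Proof.
rewrite /weight big_ord_recr /= ffun_rcons_max psum_rcons //; congr (_ * _).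
by apply: eq_bigr => i _; rewrite ffun_rcons_widen psum_rcons // ltnW.
Qed.

Definition total_weight (m n S : nat) : nat :=
  \sum_(k : {ffun 'I_m -> 'I_n} | admissible k && (psum k m == S)) weight k.

Lemma total_weight_gt (m n S : nat) : m < S -> total_weight m n S = 0.
Proof.
move=> ltmS; apply: big_pred0 => k; apply/andP => -[/admissible_psum_le lek /eqP eqS].
by move: ltmS; rewrite -eqS ltnNge lek.
Qed.

Lemma total_weight0 (n : nat) : total_weight 0 n 0 = 1.
Proof.
rewrite /total_weight (eq_bigl xpredT) => [|k]; last first.
  by rewrite psum_full big_ord0 andbT; apply/forallP; case.
rewrite (eq_bigr (fun=> 1)) => [|k _]; last by rewrite /weight big_ord0.
by rewrite sum1_card card_ffun [in X in _ ^ X]card_ord.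
Qed.

(** Once the first [m] entries have total [T], the last entry is forced to be [S - T]. The bound
    [S <= m.+1] makes the new admissibility condition automatic. *)
Lemma total_weightS (m n S : nat) : m.+1 < n -> S <= m.+1 ->
  total_weight m.+1 n S = \sum_(T < S.+1) total_weight m n T * 'C(n - T, S - T).
Proof.
move=> ltmn leSm; rewrite /total_weight.
rewrite (reindex _ (onW_bij _ (ffun_rcons_bij 'I_n m))) /=.
rewrite (eq_bigl (fun p : {ffun 'I_m -> 'I_n} * 'I_n =>
  (admissible p.1 && (psum p.1 m <= S)) && (psum p.1 m + p.2 == S))); last first.
  move=> [f a] /=; rewrite admissible_rcons psum_rcons_full.
  by case: (admissible f) => //=; lia.
rewrite -(pair_big_dep (fun f => admissible f && (psum f m <= S))
  (fun f (a : 'I_n) => psum f m + a == S) (fun f a => weight (ffun_rcons (f, a)))) /=.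
(* The default value of [inord] never occurs, as [psum f m <= S] here. *)
rewrite (partition_big (fun f => inord (psum f m) : 'I_S.+1) xpredT) //=.
apply: eq_bigr => T _; rewrite big_distrl /=; apply: eq_big => [f|f].
  have := ltn_ord T; case: (admissible f) => //= ltT.
  apply/andP/eqP => [[le_f /eqP <-] | eqT]; first by rewrite inordK.
  by rewrite eqT -ltnS inord_val.
move=> /andP[/andP[_ le_f] /eqP eqT].
have eqf : psum f m = T by rewrite -eqT inordK.
(* The forced last entry fits in ['I_n] because [S <= m.+1 < n]. *)
have lta : S - T < n by lia.
rewrite (big_pred1 (Ordinal lta)) => [|a]; first by rewrite weight_rcons eqf.
apply/eqP/eqP => [eqS | ->]; last by rewrite eqf /=; have := ltn_ord T; lia.
by apply: val_inj => /=; move: eqS; rewrite eqf; lia.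
Qed.

Lemma bin_mul_bin_sub (n S T : nat) : T <= S -> S <= n ->
  'C(n, T) * 'C(n - T, S - T) = 'C(n, S) * 'C(S, T).
Proof.
move=> leTS leSn; have le_sub : S - T <= n - T by exact: leq_sub2r.
have fact_pos : 0 < T`! * ((S - T)`! * (n - S)`!) by rewrite !muln_gt0 !fact_gt0.
apply/eqP; rewrite -(eqn_pmul2r fact_pos); apply/eqP.
have := bin_fact le_sub; rewrite (_ : n - T - (S - T) = n - S); last by lia.
move=> eq1; have eq2 := bin_fact leTS; have eq3 := bin_fact leSn.
have eq4 := bin_fact (leq_trans leTS leSn).
(* After clearing denominators both sides are [n!], the number of orderings refining a split into
   blocks of sizes [T], [S - T] and [n - S]. *)
transitivity n`!; first by rewrite -eq4 -eq1; ring.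
by rewrite -eq3 -eq2; ring.
Qed.

(** This is the binomial theorem for [(1 + x) ^ S] under the operator [x d/dx], at [x = M]. The
    factor [M.+1] avoids the exponent [S - 1], which truncates at [S = 0]. *)
Lemma sum_bin_mul_exp (M S : nat) :
  M.+1 * (\sum_(T < S.+1) 'C(S, T) * (T * M ^ T)) = S * M * M.+1 ^ S.
Proof.
case: S => [|S]; first by rewrite big_ord_recl big_ord0 /= !(mul0n, muln0).
rewrite big_ord_recl /= mul0n muln0 add0n.
rewrite (eq_bigr (fun T : 'I_S.+1 => S.+1 * M * ('C(S, T) * (1 ^ (S - T) * M ^ T)))).
  rewrite -big_distrr /= -expnDn add1n expnS; ring.
move=> T _; rewrite /bump add1n exp1n expnS.
have := mul_bin_diag S.+1 T => /= eq_diag.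
transitivity (T.+1 * 'C(S.+1, T.+1) * (M * M ^ T)); first by ring.
by rewrite -eq_diag; ring.
Qed.

Lemma sum_bin_sub_exp (M S : nat) : S <= M ->
  M.+1 * (\sum_(T < S.+1) 'C(S, T) * ((M - T) * M ^ T)) =
  M * ((M.+1 - S) * M.+1 ^ S).
Proof.
(* Adding the previous sum turns the factor [M - T] into the constant [M], leaving a plain binomial
   expansion. *)
move=> leSM; apply: (@addIn (S * M * M.+1 ^ S)).
rewrite -{1}sum_bin_mul_exp -mulnDr -big_split /=.
rewrite (eq_bigr (fun T : 'I_S.+1 => M * ('C(S, T) * (1 ^ (S - T) * M ^ T)))).
  rewrite -big_distrr /= -expnDn add1n.
  transitivity ((M.+1 - S + S) * (M * M.+1 ^ S)); last by ring.
  by rewrite subnK // leqW.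
move=> T _; have leTM : T <= M by rewrite (leq_trans _ leSM) // -ltnS.
transitivity ((M - T + T) * ('C(S, T) * M ^ T)); first by ring.
by rewrite subnK // exp1n mul1n.
Qed.

Lemma total_weightE (m n S : nat) : m < n -> S <= m.+1 ->
  m.+1 * total_weight m n S = 'C(n, S) * ((m.+1 - S) * m.+1 ^ S).
Proof.
elim: m S => [|m IHm] S ltmn leSm.
  case: S leSm => [|[]] // _; first by rewrite total_weight0 bin0.
  by rewrite total_weight_gt // subnn !(mul0n, muln0).
(* The boundary total, where both sides vanish, is included because the recurrence for length [m.+1]
   uses totals up to [m.+1] at length [m]. *)
have [->|neS] := eqVneq S m.+2; first by rewrite total_weight_gt // subnn !(mul0n, muln0).
have {neS}leSm : S <= m.+1 by lia.
rewrite total_weightS //; apply/eqP; rewrite -(eqn_pmul2l (ltn0Sn m)); apply/eqP.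
rewrite mulnCA [in RHS]mulnCA -sum_bin_sub_exp // [RHS]mulnCA; congr (_ * _).
rewrite !big_distrr /=; apply: eq_bigr => T _.
have leTS : T <= S by rewrite -ltnS.
rewrite mulnA IHm ?(ltnW ltmn) ?(leq_trans leTS) //.
rewrite [RHS]mulnA -bin_mul_bin_sub //; first by rewrite mulnAC.
exact: leq_trans leSm (ltnW ltmn).
Qed.

(** For [S > 0], Pascal's rule and [S * C(N, S) = (N - S + 1) * C(N, S - 1)] give [(N - S) * C(N +
    1, S) = N * C(N, S) - C(N, S - 1)]. *)
Lemma sum_bin_sub_exp_telescope (N j : nat) : j <= N ->
  \sum_(S < j.+1) 'C(N.+1, S) * ((N - S) * N ^ S) = N * ('C(N, j) * N ^ j).
Proof.
elim: j => [|j IHj] lejN.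
  by rewrite big_ord_recl big_ord0 !bin0 subn0 addn0 !mul1n.
rewrite big_ord_recr /= IHj ?(ltnW lejN) // binS expnS.
have := mul_bin_left N j; have [d ->] : exists d, N = d + j.+1.
  by exists (N - j.+1); rewrite subnK.
rewrite addnK.
have -> : d + j.+1 - j = d.+1 by lia.
move: 'C(_, _) 'C(_, _) (_ ^ j) => x y P eqyx.
(* Scaled by [N * N ^ j], the relation between adjacent binomials makes the goal linear in its
   monomials. *)
have : (d + j.+1) * P * (j.+1 * y) = (d + j.+1) * P * (d.+1 * x) by rewrite eqyx.
lia.
Qed.

Theorem corollary3p15 (n : nat) (hn : 1 < n) :
  (n - 1) ^ (n - 1) =
  \sum_(k : {ffun 'I_(n - 2) -> 'I_n} | admissible k)
    \prod_(j < n - 2) 'C(n - psum k j, k j).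
Proof.
case: n hn => [|[|m]] // _; rewrite !subSS !subn0.
rewrite (partition_big (fun k => inord (psum k m) : 'I_m.+1) xpredT) //=.
rewrite (eq_bigr (fun S : 'I_m.+1 => total_weight m m.+2 S)) => [|S _]; last first.
  apply: eq_bigl => k; case admk: (admissible k) => //=.
  by rewrite -val_eqE /= inordK // ltnS admissible_psum_le.
apply/eqP; rewrite -(eqn_pmul2l (ltn0Sn m)) big_distrr /=; apply/eqP.
rewrite [RHS](eq_bigr (fun S : 'I_m.+1 =>
  'C(m.+2, S) * ((m.+1 - S) * m.+1 ^ S))) => [|S _].
  (* With [N = m.+1] the sum stops at [j = m], where ['C(N, m) = N] supplies the last power of
     [N]. *)
  by rewrite sum_bin_sub_exp_telescope // binSn expnS.
by rewrite total_weightE // ltnW.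
Qed.
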